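(* Consider the DC power flow model on a grid $\mathcal G$ with independent Gaussian nodal injection fluctuations whose variances are equal at all nodes, and with constant susceptance per unit length on all lines, i.e. $\beta_{ab}=l_{ab}\beta_u$ for every line $(ab)$, where $l_{ab}>0$ is the length of $(ab)$ and $\beta_u>0$ is a constant. Let $(ij)$ be an edge of $\mathcal G$ and let $\mathcal K$, with $|\mathcal K|\ge1$, be the set of nodes that are neighbors of both $i$ and $j$ in $\mathcal G$. Then $\Sigma_\theta^{-1}(i,j)<0$ if $$l_{ij}>\frac{\max_{k\in\mathcal K,\,r\in\{i,j\}}l_{kr}}{1+\sqrt{1+2/|\mathcal K|}}.$$
   Context: Power grid: a finite connected simple undirected graph with $N$ non-reference buses and one reference bus; each line $(ij)$ has susceptance $\beta_{ij}=\beta_{ji}>0$. The reference bus is ignored in the analysis: $\mathcal G$ denotes the graph on the $N$ non-reference buses, with the lines between them as edges. Reduced weighted Laplacian $H_\beta\in\mathbb R^{N\times N}$: $H_\beta(i,i)=\sum_k\beta_{ik}$ (sum over all lines at $i$, including a line to the reference bus), $H_\beta(i,j)=-\beta_{ij}$ if $(ij)$ is a line between distinct non-reference buses, and $0$ otherwise. $H_\beta$ is invertible. DC power flow model: $p=H_\beta\theta$, with $p\sim\mathcal N(0,\Sigma_p)$ the active injections, $\Sigma_p$ diagonal with positive diagonal entries (here all equal), and $\theta$ the phase angles; the covariance matrix of $\theta$ is $\Sigma_\theta=H_\beta^{-1}\Sigma_pH_\beta^{-1}$. *)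

(* Defs.v *)
From HB Require Import structures.
From mathcomp Require Import all_boot all_order all_algebra.
From mathcomp Require Import all_classical all_reals all_analysis.

Set Implicit Arguments.
Unset Strict Implicit.
Unset Printing Implicit Defensive.

Import Order.TTheory GRing.Theory Num.Theory.
Import numFieldNormedType.Exports.

Local Open Scope ring_scope.

(* Buses: [None] is the reference bus, [Some i] the i-th non-reference bus. *)
Notation bus N := (option 'I_N).

(* The values of [susceptance] on pairs of buses that are not joined by a line
   are irrelevant. *)
Record grid (R : realType) (N : nat) := Grid {
  line : rel (bus N);
  susceptance : bus N -> bus N -> R;
  line_sym : symmetric line;
  line_irr : irreflexive line;
  line_connected : forall a b : bus N, connect line a b;
  susceptance_sym : forall a b : bus N,
    line a b -> susceptance a b = susceptance b a;
  susceptance_gt0 : forall a b : bus N, line a b -> 0 < susceptance a b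
}.

Section Grid.
Variables (R : realType) (N : nat) (G : grid R N).

(* Adjacency between non-reference buses. *)
Definition edge : rel 'I_N := fun i j => line G (Some i) (Some j).

Definition common_neighbors (i j : 'I_N) : {set 'I_N} :=
  [set k | edge k i && edge k j]%SET.

(* In the diagonal entries [a] ranges over all buses, including the reference
   bus. *)
Definition reduced_laplacian : 'M[R]_N :=
  \matrix_(i, j)
    if i == j then \sum_(a : bus N | line G (Some i) a) susceptance G (Some i) a
    else if edge i j then - susceptance G (Some i) (Some j)
    else 0.

End Grid.

Section GaussianVector.
Variables (R : realType) (d : measure_display) (T : measurableType d).
Variables (P : probability T R) (n : nat).

(* N(0, v) on the real line, with N(0, 0) the Dirac mass at 0 ([normal_prob]
   takes the standard deviation, and is a junk value when the latter is 0). *)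
Definition centered_normal (v : R) : set R -> \bar R :=
  if v == 0 then dirac (0 : R) else normal_prob 0 (Num.sqrt v).

(* X ~ N(0, S): S is symmetric positive semidefinite and every linear
   combination of the components of X is Gaussian, with the mean and variance
   prescribed by S. *)
Definition gaussian_vector (X : 'I_n -> {RV P >-> R}) (S : 'M[R]_n) : Prop :=
  [/\ S^T = S,
      forall u : 'rV[R]_n, 0 <= (u *m S *m u^T) 0 0 &
      forall (u : 'rV[R]_n) (A : set R), measurable A ->
        pushforward P (fun w => \sum_i u 0 i * X i w) A =
        centered_normal ((u *m S *m u^T) 0 0) A].

Definition covariance_matrix (X : 'I_n -> {RV P >-> R}) : 'M[R]_n :=
  \matrix_(i, j) fine (covariance P (X i) (X j)).

End GaussianVector.

(* p ~ N(0, S) with S = diag_mx v, i.e. the injections p_i are independent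
   centered Gaussians with variances v_i > 0, and p = H theta. *)
Definition dc_power_flow (R : realType) (N : nat) (G : grid R N)
    (d : measure_display) (T : measurableType d) (P : probability T R)
    (v : 'rV[R]_N) (p theta : 'I_N -> {RV P >-> R}) : Prop :=
  [/\ forall i, 0 < v 0 i,
      gaussian_vector p (diag_mx v) &
      forall w : T,
        \col_i p i w = reduced_laplacian G *m \col_i theta i w].

(* Main.v *)
(* With equal injection variances s, the inverse covariance matrix of theta is a
   positive multiple of H^2, and
     (H^2)(i,j) = - beta_ij (H(i,i) + H(j,j)) + sum_{k in K} beta_ki beta_kj.
   Bounding H(i,i) and H(j,j) below by the contributions of j, resp. i, and of
   the common neighbours, it suffices that, for a = beta_ij,
     x y - a (x + y) = (x - a) (y - a) - a^2 < 2 a^2 / |K|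
   for x = beta_ki and y = beta_kj, which holds when x, y < a (1 + t) with
   t = sqrt (1 + 2 / |K|), because then |x - a| and |y - a| are less than a t.

   The covariance matrix is computed up to the unknown constant c, the variance
   of the standard normal law: by the definition of a Gaussian vector, a linear
   combination of the injections becomes standard normal after rescaling, so its
   variance is c times the value of the quadratic form, and covariances follow
   by polarization. *)
Require Import Defs.
From HB Require Import structures.
From mathcomp Require Import all_boot all_order all_algebra.
From mathcomp Require Import all_classical all_reals all_analysis.
From mathcomp Require Import measurable_realfun.
From mathcomp Require Import ring lra.

Set Implicit Arguments.
Unset Strict Implicit.
Unset Printing Implicit Defensive.

Import Order.TTheory GRing.Theory Num.Theory.
Import numFieldNormedType.Exports.

Local Open Scope ring_scope.

(** * Sign of an off-diagonal entry of the squared reduced Laplacian *)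

Lemma prod_subr_lt (R : realFieldType) (a s x y : R) : 0 < a -> 1 < s ->
  0 <= x < a * (1 + s) -> 0 <= y < a * (1 + s) ->
  (x - a) * (y - a) < (a * s) ^+ 2.
Proof.
move=> a0 s1 /andP[x0 xs] /andP[y0 ys].
have as1 : a < a * s by rewrite ltr_pMr.
(* For [z] below [a], nonnegativity only gives a deviation of at most [a], which is why [1 < s]
   matters. *)
have dev z : 0 <= z -> z < a * (1 + s) -> `|z - a| < a * s.
  by move=> z0 zs; rewrite ltr_norml; apply/andP; split; lra.
apply: le_lt_trans (ler_norm _) _; rewrite normrM expr2.
by apply: ltr_pM => //; exact: dev.
Qed.

Section ReducedLaplacian.
Variables (R : realType) (N : nat) (G : grid R N).
Local Notation H := (reduced_laplacian G).
Local Notation beta a b := (susceptance G (Some a) (Some b)).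

Lemma edge_sym : symmetric (edge G).
Proof. by move=> a b; exact: line_sym. Qed.

Lemma edge_irr : irreflexive (edge G).
Proof. by move=> a; exact: line_irr. Qed.

Lemma reduced_laplacian_tr : H^T = H.
Proof.
apply/matrixP => a b; rewrite !mxE eq_sym edge_sym.
case: eqVneq => [->//|_].
by case: ifP => // ab; rewrite -susceptance_sym.
Qed.

(** The lines left out, possibly one to the reference bus among them, have positive susceptance. *)
Lemma degree_ge (a : 'I_N) (A : {set 'I_N}) : {in A, forall k, edge G a k} ->
  \sum_(k in A) beta a k <= H a a.
Proof.
move=> Aa; rewrite mxE eqxx.
have SomeI : {in A &, injective Some} by move=> x y _ _ [].
have <- := big_imset (susceptance G (Some a)) SomeI.
rewrite [leRHS](bigID (mem (Some @: A)))/= [X in _ <= X + _](_ : _ =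
    \sum_(b in (Some @: A)%SET) susceptance G (Some a) b); last first.
  by apply: eq_bigl => b; rewrite andb_idl// => /imsetP[k kA ->]; exact: Aa.
by rewrite lerDl sumr_ge0// => b /andP[ab _]; rewrite ltW// susceptance_gt0.
Qed.

(** In the matrix product, the indices [i] and [j] yield the diagonal part; any other index
    contributes only when adjacent to both, and then the two minus signs cancel. *)
Lemma reduced_laplacian_sqr_adj (i j : 'I_N) : edge G i j ->
  (H *m H) i j = - beta i j * (H i i + H j j)
                 + \sum_(k in common_neighbors G i j) beta k i * beta k j.
Proof.
move=> ij; have ineqj : i != j by apply: contraTneq ij => ->; rewrite edge_irr.
have Hij : H i j = - beta i j by rewrite mxE (negbTE ineqj) ij.
rewrite mxE (bigD1 i)//= (bigD1 j) 1?eq_sym//= Hij.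
rewrite addrA [H i i * _]mulrC -mulrDr; congr (_ + _).
rewrite (bigID (mem (common_neighbors G i j)))/= [X in _ + X]big1 ?addr0.
  apply: eq_big => [k|k /andP[_]].
    rewrite andb_idl// inE => /andP[ki kj].
    by apply/andP; split; [move: ki|move: kj]; apply: contraTneq => ->;
      rewrite edge_irr.
  rewrite inE => /andP[ki kj].
  have [ik kj'] : i != k /\ k != j.
    by split; [move: ki|move: kj]; apply: contraTneq => ->; rewrite edge_irr.
  rewrite !mxE (negbTE ik) (negbTE kj') edge_sym ki kj mulrNN.
  by rewrite susceptance_sym// -/(edge G i k) edge_sym.
move=> k /andP[/andP[ki kj]]; rewrite inE negb_and !mxE eq_sym (negbTE ki).
rewrite (negbTE kj) edge_sym => /orP[] /negbTE ->; first by rewrite mul0r.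
by rewrite mulr0.
Qed.

Lemma reduced_laplacian_sqr_lt0 (i j : 'I_N) :
    let K := common_neighbors G i j in
    edge G i j -> (0 < #|K|)%N ->
    {in K, forall k r, r \in [set i; j]%SET ->
       beta k r < beta i j * (1 + Num.sqrt (1 + 2 / #|K|%:R))} ->
  (H *m H) i j < 0.
Proof.
move=> K ij K0 bK; rewrite reduced_laplacian_sqr_adj// -/K.
set b := beta i j; set s := Num.sqrt _ in bK.
have b0 : 0 < b by exact: susceptance_gt0.
have n0 : 0 < #|K|%:R :> R by rewrite ltr0n.
have s2 : s ^+ 2 = 1 + 2 / #|K|%:R.
  by rewrite sqr_sqrtr// addr_ge0// divr_ge0// ltW.
have s1 : 1 < s.
  by rewrite -[ltLHS]sqrtr1 ltr_sqrt ?ltrDl ?addr_gt0 ?divr_gt0.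
have KP k : k \in K -> edge G k i /\ edge G k j by rewrite inE => /andP.
have iNK : i \notin K by rewrite inE edge_irr.
have jNK : j \notin K by rewrite inE edge_irr andbF.
have degi : b + \sum_(k in K) beta k i <= H i i.
  have := @degree_ge i (j |: K); rewrite big_setU1//=.
  rewrite [X in _ + X](eq_bigr (fun k => beta k i)); last first.
    by move=> k /KP[ki _]; rewrite susceptance_sym// -/(edge G i k) edge_sym.
  apply => k; rewrite in_setU1 => /predU1P[->//|/KP[ki _]].
  by rewrite edge_sym.
have degj : b + \sum_(k in K) beta k j <= H j j.
  have := @degree_ge j (i |: K); rewrite big_setU1//=.
  rewrite /b (susceptance_sym ij).
  rewrite [X in _ + X](eq_bigr (fun k => beta k j)); last first.
    by move=> k /KP[_ kj]; rewrite susceptance_sym// -/(edge G j k) edge_sym.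
  apply => k; rewrite in_setU1 => /predU1P[->|/KP[_ kj]].
    by rewrite edge_sym.
  by rewrite edge_sym.
(* Summed over [K], these bounds give [2 * b ^+ 2], exactly what the line between [i] and [j] adds
   to [b * (H i i + H j j)] through [degi] and [degj]. *)
have term k : k \in K ->
    beta k i * beta k j - b * (beta k i + beta k j) < 2 * b ^+ 2 / #|K|%:R.
  move=> kK; have [ki kj] := KP _ kK.
  have /(_ (beta k i) (beta k j)) := prod_subr_lt b0 s1.
  rewrite exprMn s2 (ltW (susceptance_gt0 ki)) (ltW (susceptance_gt0 kj)) /=.
  rewrite (bK _ kK i (set21 _ _)) (bK _ kK j (set22 _ _)) => /(_ isT isT).
  lra.
have : \sum_(k in K) (beta k i * beta k j - b * (beta k i + beta k j))
    < \sum_(k in K) (2 * b ^+ 2 / #|K|%:R).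
  (* One common neighbour is split off to keep the summed inequality strict. *)
  have [k kK] := card_gt0P K0.
  rewrite (bigD1 k)//= [ltRHS](bigD1 k)//= ltr_leD ?term//.
  by apply: ler_sum => l /andP[lK _]; rewrite ltW// term.
rewrite sumr_const -[ltRHS]mulr_natr divfK ?gt_eqF// sumrB.
rewrite -mulr_sumr big_split/=.
move=> sum_lt.
have : b * (b + \sum_(k in K) beta k i) <= b * H i i by rewrite ler_pM2l.
have : b * (b + \sum_(k in K) beta k j) <= b * H j j by rewrite ler_pM2l.
by rewrite expr2 in sum_lt; lra.
Qed.

End ReducedLaplacian.

(** * Transfer of square integrability and variance through equality in law *)

Section SecondMoment.
Context d (T : measurableType d) (R : realType).

Lemma Lfun2_sqr_integral (mu : {measure set T -> \bar R}) (f : T -> R) :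
  measurable_fun setT f -> (\int[mu]_x (f x ^+ 2)%:E < +oo)%E ->
  f \in Lfun mu 2%:E.
Proof.
move=> mf f2; rewrite inE; apply/andP; split; rewrite inE//=.
rewrite /finite_norm unlock poweR_lty//.
by under eq_integral do rewrite /= powR_mulrn// real_normK ?num_real//.
Qed.

Variables (P : probability T R) (nu : probability (measurableTypeR R) R).
Variable X : {RV P >-> R}.
Hypothesis PX : forall A : set R, measurable A -> distribution P X A = nu A.
(* [R] and [measurableTypeR R] have the same measurable sets but different
   displays; random variables take their values in the former, whereas
   [normal_prob] is a measure on the latter. *)
Let idR : measurableTypeR R -> R := idfun.
Hypothesis nu2 : idR \in Lfun nu 2%:E.

#[local] HB.instance Definition _ :=
  @isMeasurableFun.Build _ _ _ _ idR (@measurable_id _ _ setT).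

(** As a set function, [distribution nu idR] is [nu]; this form lets the change of variables formula
    apply on both sides. *)
Let integral_law (f : R -> \bar R) :
  (\int[distribution P X]_y f y = \int[distribution nu idR]_y f y)%E.
Proof. by apply: eq_measure_integral => A mA _; exact: PX. Qed.

Let integral_sqr : (\int[P]_x (X x ^+ 2)%:E = \int[nu]_y (idR y ^+ 2)%:E)%E.
Proof.
have msqr : measurable_fun [set: R] (fun y : R => (y ^+ 2)%:E).
  by apply/measurable_EFinP; exact: exprn_measurable.
have sqr0 (y : R) : (0 <= (y ^+ 2)%:E)%E by rewrite lee_fin sqr_ge0.
have := ge0_integral_distribution X msqr sqr0.
by rewrite integral_law (ge0_integral_distribution _ msqr sqr0) => <-.
Qed.

Lemma distribution_Lfun2 : (X : T -> R) \in Lfun P 2%:E.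
Proof.
apply: Lfun2_sqr_integral => //; rewrite integral_sqr.
by have /integrable_lty := Lfun2_integrable_sqr nu2; exact.
Qed.

Lemma distribution_variance : 'V_P[X] = 'V_nu[idR].
Proof.
have X2 := distribution_Lfun2.
rewrite (varianceE X2) (varianceE nu2).
suff -> : ('E_P[X] = 'E_nu[idR])%E.
  by congr (_ - _)%E; rewrite unlock; exact: integral_sqr.
have iX : P.-integrable setT (EFin \o X).
  exact/Lfun1_integrable/(Lfun_subset12 (fin_num_measure P _ measurableT) X2).
have inu : nu.-integrable setT (EFin \o idR).
  exact/Lfun1_integrable/(Lfun_subset12 (fin_num_measure nu _ measurableT) nu2).
rewrite unlock -(integral_distribution _ iX)// integral_law.
by rewrite (integral_distribution _ inu).
Qed.

End SecondMoment.

(** * Finiteness and positivity of the standard normal variance *)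

Section NormalProb.
Variable R : realType.
Local Notation mu := (@lebesgue_measure R).
Local Open Scope ereal_scope.

(** The Radon-Nikodym derivative and [normal_pdf] have the same integral over every measurable set,
    so they agree almost everywhere. *)
Lemma ge0_integral_normal_prob (m s : R) (f : measurableTypeR R -> \bar R) :
  measurable_fun setT f -> (forall x, 0 <= f x) ->
  \int[normal_prob m s]_x f x = \int[mu]_x (f x * (normal_pdf m s x)%:E).
Proof.
move=> mf f0; have dom := normal_prob_dominates m s.
rewrite -(Radon_Nikodym_SigmaFinite.change_of_variables dom)//.
have iRN := Radon_Nikodym_SigmaFinite.f_integrable dom.
have mpdf : measurable_fun setT (EFin \o normal_pdf m s).
  by apply/measurable_EFinP; exact: measurable_normal_pdf.
apply: ae_eq_integral => //.
- by apply: emeasurable_funM => //; exact: measurable_int iRN.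
- exact: emeasurable_funM.
- apply: ae_eqe_mul2l; apply: integral_ae_eq => // A _ mA.
  by rewrite -Radon_Nikodym_SigmaFinite.f_integral.
Qed.

(** Domination by a wider normal density, whose integral is known. The exponents differ by
    [3 * x ^+ 2 / 8], and [x ^+ 2 <= 8 * expR (3 * x ^+ 2 / 8)] follows from [1 + y <= expR y]; the
    ratio of peaks adjusts the normalization. *)
Let sqr_pdf_le (x : R) :
  (x ^+ 2 * normal_pdf 0 1 x <=
   (8 * normal_peak 1 / normal_peak 2) * normal_pdf 0 2 x)%R.
Proof.
rewrite !normal_pdfE ?oner_eq0 ?pnatr_eq0// [leRHS]mulrA divfK; last first.
  by rewrite gt_eqF// normal_peak_gt0 ?pnatr_eq0.
rewrite mulrCA [(8 * _)%R]mulrC -[leRHS]mulrA ler_wpM2l ?normal_peak_ge0//.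
rewrite /normal_fun subr0.
have -> : (- x ^+ 2 / (2 ^+ 2 *+ 2) =
    x ^+ 2 * (3 / 8) + - x ^+ 2 / (1 ^+ 2 *+ 2))%R.
  by field.
rewrite expRD mulrA ler_wpM2r ?expR_ge0//.
by have := expR_ge1Dx (x ^+ 2 * (3 / 8)); have := sqr_ge0 x; lra.
Qed.

Let idR : measurableTypeR R -> R := idfun.

Lemma normal_prob_Lfun2 : idR \in Lfun (normal_prob 0 1) 2%:E.
Proof.
apply: Lfun2_sqr_integral; first exact: (@measurable_id _ _ setT).
rewrite ge0_integral_normal_prob; last 2 first.
- by apply/measurable_EFinP; exact: exprn_measurable.
- by move=> x; rewrite lee_fin sqr_ge0.
have [K K0 leK] : exists2 K : R, (0 <= K)%R &
    forall x, (x ^+ 2 * normal_pdf 0 1 x <= K * normal_pdf 0 2 x)%R.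
  exists (8 * normal_peak 1 / normal_peak 2)%R => //.
  by rewrite !mulr_ge0 ?invr_ge0 ?normal_peak_ge0.
apply: (@le_lt_trans _ _ (\int[mu]_x (K%:E * (normal_pdf 0 2 x)%:E))).
  apply: ge0_le_integral => //.
  - by move=> x _; rewrite lee_fin mulr_ge0 ?sqr_ge0 ?normal_pdf_ge0.
  - apply/measurable_EFinP; apply: measurable_funM.
      exact: exprn_measurable.
    exact: measurable_normal_pdf.
  - apply/measurable_EFinP; apply: measurable_funM => //.
    exact: measurable_normal_pdf.
  - by move=> x _; rewrite -!EFinM lee_fin leK.
rewrite integralZl//; last exact: integrable_normal_pdf.
by rewrite integral_normal_pdf mule1 ltry.
Qed.

(* Its value is 1, but only its being positive and finite is needed. *)
Definition std_normal_variance : R := fine 'V_(normal_prob 0 1)[idR].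

Lemma std_normal_varianceE :
  'V_(normal_prob 0 1)[idR] = std_normal_variance%:E.
Proof. by rewrite fineK// variance_fin_num// normal_prob_Lfun2. Qed.

(** Zero variance would concentrate the law on its mean, a Lebesgue null set, against absolute
    continuity. *)
Lemma std_normal_variance_gt0 : (0 < std_normal_variance)%R.
Proof.
rewrite -lte_fin -std_normal_varianceE lt0e variance_ge0 andbT; apply/eqP.
rewrite /variance unlock; set c := fine _; rewrite unlock => V0.
pose f := fun x : measurableTypeR R => ((x - c) * (x - c))%:E.
have mf : measurable_fun [set: measurableTypeR R] f.
  by apply/measurable_EFinP; apply: measurable_funM; exact: measurable_funB.
have : \int[normal_prob 0 1]_x `|f x| = 0.
  rewrite -V0; apply: eq_integral => x _.
  by rewrite gee0_abs// lee_fin -expr2 sqr_ge0.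
move=> /(ae_eq_integral_abs _ measurableT mf)[N [mN N0 subN]].
have c0 : normal_prob 0 1 [set c] = 0.
  have /null_content_dominatesP := normal_prob_dominates (0 : R) 1.
  by apply => //; exact: lebesgue_measure_set1.
suff /eqP : normal_prob 0 1 [set: R] = 0 by rewrite probability_setT onee_eq0.
have cN : ([set: R] `<=` [set c] `|` N)%classic.
  move=> x _; have [->|xc] := eqVneq x c; first by left.
  right; apply: subN => /= /(_ I) /eqP.
  by rewrite /f eqe mulf_eq0 orbb subr_eq0 (negbTE xc).
have mcN : measurable ([set c] `|` N)%classic by exact: measurableU.
apply/eqP; rewrite -measure_le0.
apply: (le_trans (le_measure (normal_prob (0 : R) 1) _ _ cN)); rewrite ?inE//.
have := @measureU0 _ (measurableTypeR R) R (normal_prob 0 1)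
  _ _ (measurable_set1 c) mN N0.
by move=> /(fun cN0 => etrans cN0 c0)/eqP; rewrite eq_le => /andP[].
Qed.

End NormalProb.

(** * Covariances of linear combinations of a Gaussian vector *)

Section GaussianVector.
Context d (T : measurableType d) (R : realType) (P : probability T R) (n : nat).
Variables (X : 'I_n -> {RV P >-> R}) (S : 'M[R]_n).
Hypothesis gX : gaussian_vector X S.

Local Notation c := (std_normal_variance R).

Let form (u w : 'rV[R]_n) : R := (u *m S *m w^T) 0 0.

Let is_comb (u : 'rV[R]_n) (Y : {RV P >-> R}) :=
  forall w, Y w = \sum_i u 0 i * X i w.

Let law u Y : is_comb u Y ->
  forall A : set R, measurable A ->
  distribution P Y A = centered_normal (form u u) A.
Proof.
move=> YE A mA; have [_ _ /(_ u A mA) <-] := gX.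
by congr (P _); apply/seteqP; split => w /=; rewrite YE.
Qed.

Lemma gaussian_comb_variance (u : 'rV[R]_n) (Y : {RV P >-> R}) :
  (forall w, Y w = \sum_i u 0 i * X i w) ->
  (Y : T -> R) \in Lfun P 2%:E /\ 'V_P[Y] = (c * (u *m S *m u^T) 0 0)%:E.
Proof.
rewrite -/(form u u) => YE.
have [_ /(_ u) q0 _] := gX; rewrite -/(form u u) in q0.
(* When the form vanishes no rescaling is possible; the law is then the Dirac mass at 0, of variance
   0. *)
have [q_eq0|q_neq0] := eqVneq (form u u) 0.
  pose delta : probability (measurableTypeR R) R :=
    dirac (0 : measurableTypeR R).
  have lawY : forall A : set R, measurable A -> distribution P Y A = delta A.
    by move=> A mA; rewrite (law YE)// q_eq0 /centered_normal eqxx.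
  have msqr : measurable_fun [set: measurableTypeR R]
      (fun x : measurableTypeR R => (x ^+ 2)%:E).
    by apply/measurable_EFinP; exact: exprn_measurable.
  have d2 : (idfun : measurableTypeR R -> R) \in Lfun delta 2%:E.
    apply: Lfun2_sqr_integral; first exact: (@measurable_id _ _ setT).
    by rewrite (integral_dirac _ measurableT msqr) diracT mul1e ltry.
  split; first exact: distribution_Lfun2 lawY d2.
  rewrite (distribution_variance lawY d2) q_eq0 mulr0 (varianceE d2) unlock.
  rewrite (integral_dirac _ measurableT msqr).
  rewrite (integral_dirac _ measurableT); last first.
    by apply/measurable_EFinP; exact: (@measurable_id _ _ setT).
  by rewrite !diracT !mul1e/= expr0n/= mulr0 oppr0 adde0.
pose s := Num.sqrt (form u u).
have s2 : s ^+ 2 = form u u by rewrite sqr_sqrtr.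
have s0 : s != 0 by rewrite sqrtr_eq0 -ltNge lt0r q_neq0.
pose Z : {RV P >-> R} := (s^-1 \o* Y)%R.
have ZE w : Z w = \sum_i (s^-1 *: u) 0 i * X i w.
  rewrite /Z/= YE mulr_suml; apply: eq_bigr => i _.
  by rewrite mxE mulrC mulrA.
have formZ : form (s^-1 *: u) (s^-1 *: u) = 1.
  rewrite /form linearZ/= -!scalemxAl -scalemxAr 2!mxE -/(form u u) -s2.
  by rewrite mulrA -expr2 exprVn mulVf// expf_neq0.
have lawZ : forall A : set R, measurable A ->
    distribution P Z A = normal_prob 0 1 A.
  by move=> A mA; rewrite (law ZE)// formZ /centered_normal oner_eq0 sqrtr1.
have Z2 := distribution_Lfun2 lawZ (normal_prob_Lfun2 R).
have YZ : (Y : T -> R) = (s \o* Z)%R.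
  by apply/funext => w; rewrite /Z/= divfK.
rewrite YZ; split; first by rewrite Lfun_scale// ler1n.
rewrite varianceZ// (distribution_variance lawZ (normal_prob_Lfun2 R)).
by rewrite std_normal_varianceE s2 -EFinM mulrC.
Qed.

Lemma gaussian_comb_covariance (u1 u2 : 'rV[R]_n) (Y1 Y2 : {RV P >-> R}) :
  (forall w, Y1 w = \sum_i u1 0 i * X i w) ->
  (forall w, Y2 w = \sum_i u2 0 i * X i w) ->
  covariance P Y1 Y2 = (c * (u1 *m S *m u2^T) 0 0)%:E.
Proof.
move=> Y1E Y2E.
have [Y12 V1] := gaussian_comb_variance Y1E.
have [Y22 V2] := gaussian_comb_variance Y2E.
pose Y : {RV P >-> R} := (Y1 \+ Y2)%R.
have YE w : Y w = \sum_i (u1 + u2) 0 i * X i w.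
  rewrite /Y/= Y1E Y2E -big_split/=; apply: eq_bigr => i _.
  by rewrite mxE mulrDl.
have [_] := gaussian_comb_variance YE.
have [Ssym _ _] := gX.
have sym : (u2 *m S *m u1^T) 0 0 = (u1 *m S *m u2^T) 0 0.
  have -> : u2 *m S *m u1^T = (u1 *m S *m u2^T)^T.
    by rewrite !trmx_mul trmxK Ssym mulmxA.
  by rewrite mxE.
(* Finiteness allows the formula for the variance of a sum to be read in [R] and solved for the
   covariance. *)
have cov_fin : covariance P Y1 Y2 \is a fin_num.
  rewrite covariance_fin_num ?Lfun2_mul_Lfun1//;
    by rewrite Lfun_subset12 ?fin_num_measure.
rewrite (varianceD Y12 Y22) V1 V2 -(fineK cov_fin) -EFinM -!EFinD => -[].
have mx11D (A B : 'M[R]_1) : (A + B) 0 0 = A 0 0 + B 0 0 by rewrite mxE.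
rewrite linearD/= !mulmxDl !mulmxDr !mx11D sym => Vsum.
by congr EFin; lra.
Qed.

End GaussianVector.

(** * Covariance of the phase angles and its inverse *)

Section DCPowerFlow.
Context (R : realType) (N : nat) (G : grid R N) (d : measure_display).
Context (T : measurableType d) (P : probability T R) (v : 'rV[R]_N).
Variables p theta : 'I_N -> {RV P >-> R}.
Hypothesis Hdc : dc_power_flow G v p theta.
Local Notation H := (reduced_laplacian G).
Local Notation c := (std_normal_variance R).

(* If [u *m H = 0], then the combination [u] of the injections vanishes
   identically, hence so does its variance, which is a positive definite
   quadratic form in [u]. *)
Lemma reduced_laplacian_unit : H \in unitmx.
Proof.
have [v0 gp pE] := Hdc.
rewrite -row_free_unit -kermx_eq0; apply/negPn/negP => /rowV0Pn[u].
move=> /sub_kermxP uH; apply/negP; rewrite negbK.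
pose Y : {RV P >-> R} := cst 0.
have YE w : Y w = \sum_i u 0 i * p i w.
  transitivity ((u *m \col_i p i w) 0 0).
    by rewrite pE mulmxA uH mul0mx mxE.
  by rewrite mxE; apply: eq_bigr => i _; rewrite mxE.
have := gaussian_comb_covariance gp YE YE.
rewrite covariance_cst_l => -[] /esym/eqP.
rewrite mulf_eq0 gt_eqF ?std_normal_variance_gt0//= mxE.
under eq_bigr => i _ do rewrite mul_mx_diag !mxE mulrAC -expr2.
rewrite psumr_eq0 => [/allP u0|i _]; last by rewrite mulr_ge0 ?sqr_ge0// ltW.
apply/eqP/rowP => i; have := u0 i (mem_index_enum _).
by rewrite mulf_eq0 sqrf_eq0 [X in _ || X]gt_eqF// orbF mxE => /eqP.
Qed.

Lemma covariance_matrix_theta :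
  covariance_matrix theta = c *: (invmx H *m diag_mx v *m (invmx H)^T).
Proof.
have [v0 gp pE] := Hdc.
have thetaE a w : theta a w = \sum_i (row a (invmx H)) 0 i * p i w.
  transitivity ((invmx H *m \col_i p i w) a 0).
    by rewrite pE mulKmx ?reduced_laplacian_unit// mxE.
  by rewrite mxE; apply: eq_bigr => i _; rewrite !mxE.
apply/matrixP => a b.
rewrite mxE (gaussian_comb_covariance gp (thetaE a) (thetaE b))/=.
rewrite [RHS]mxE; congr (_ * _).
by rewrite -row_mul tr_row !mxE; apply: eq_bigr => k _; rewrite !mxE.
Qed.

Lemma invmx_covariance_matrix_theta (s : R) : v = const_mx s -> 0 < s ->
  invmx (covariance_matrix theta) = (c * s)^-1 *: (H *m H).
Proof.
move=> vs s0.
have Hu := reduced_laplacian_unit.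
have cs0 : c * s != 0 by rewrite gt_eqF// mulr_gt0 ?std_normal_variance_gt0.
have covE : covariance_matrix theta = (c * s) *: (invmx H *m invmx H).
  rewrite covariance_matrix_theta vs diag_const_mx trmx_inv.
  by rewrite reduced_laplacian_tr mul_mx_scalar -scalemxAl scalerA.
(* [invmx] is a genuine inverse only on invertible matrices; exhibiting a right inverse gives both
   invertibility and the value. *)
have cov1 : covariance_matrix theta *m ((c * s)^-1 *: (H *m H)) = 1%:M.
  rewrite covE -scalemxAl -scalemxAr scalerA divff// scale1r.
  by rewrite mulmxA mulmxKV// mulVmx.
have [covu _] := mulmx1_unit cov1.
by rewrite -[LHS]mulmx1 -cov1 mulKmx.
Qed.

End DCPowerFlow.

Theorem corollary2 (R : realType) (N : nat) (G : grid R N)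
    (d : measure_display) (T : measurableType d) (P : probability T R)
    (v : 'rV[R]_N) (p theta : 'I_N -> {RV P >-> R})
    (Hdc : dc_power_flow G v p theta)
    (Hvar : forall a b : 'I_N, v 0 a = v 0 b)
    (l : bus N -> bus N -> R) (beta_u : R)
    (Hl : forall a b : bus N, line G a b -> 0 < l a b)
    (Hbeta_u : 0 < beta_u)
    (Hbeta : forall a b : bus N, line G a b -> susceptance G a b = l a b * beta_u)
    (i j : 'I_N) (Hij : edge G i j)
    (HK : (1 <= #|common_neighbors G i j|)%N)
    (Hlen : l (Some i) (Some j) >
      (\big[Num.max/0]_(k in common_neighbors G i j)
         \big[Num.max/0]_(r in [set i; j]%SET) l (Some k) (Some r))
      / (1 + Num.sqrt (1 + 2 / (#|common_neighbors G i j|)%:R))) :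
  invmx (covariance_matrix theta) i j < 0.
Proof.
have [v0 _ _] := Hdc.
have vs : v = const_mx (v 0 i) by apply/rowP => a; rewrite mxE.
rewrite (invmx_covariance_matrix_theta Hdc vs (v0 i)) mxE.
rewrite pmulr_rlt0 ?invr_gt0 ?mulr_gt0 ?std_normal_variance_gt0//.
apply: reduced_laplacian_sqr_lt0 => // k kK r rij.
have kr : line G (Some k) (Some r).
  move: kK rij; rewrite !inE => /andP[ki kj] /predU1P[->//|/eqP->//].
have s0 : 0 < 1 + Num.sqrt (1 + 2 / (#|common_neighbors G i j|)%:R) :> R.
  by rewrite ltr_pwDl// sqrtr_ge0.
(* The common factor [beta_u] cancels, leaving a comparison of lengths. *)
rewrite (Hbeta _ _ kr) (Hbeta _ _ Hij) mulrAC ltr_pM2r//.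
rewrite -ltr_pdivrMr//; apply: le_lt_trans Hlen.
rewrite ler_pM2r ?invr_gt0//.
(* The default 0 of the maxima is harmless: each maximum still bounds its members from above. *)
apply: le_trans (le_bigmax_cond _ _ kK).
exact: le_bigmax_cond rij.
Qed.
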